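(* (1) Any right semi-hereditary ring is right $\mathcal F_1^{\mathrm{fp}}$-coherent. (2) Any right coherent ring, and thus any right Noetherian ring, is right $\mathcal F_1^{\mathrm{fp}}$-coherent. (3) Any right perfect ring is right $\mathcal F_1^{\mathrm{fp}}$-coherent. (4) Any semi-coherent ring is $\mathcal F_1^{\mathrm{fp}}$-coherent. (5) Any integral domain is $\mathcal F_1^{\mathrm{fp}}$-coherent.
   Context: Rings are associative with unit and modules are unital. A ring $R$ is right $\mathcal F_1^{\mathrm{fp}}$-coherent if every finitely generated flat right submodule of a free right $R$-module is finitely presented (and thus projective); for commutative rings one simply says $\mathcal F_1^{\mathrm{fp}}$-coherent. A ring $R$ is semi-coherent if it is commutative and $\mathrm{Hom}_R(B,C)$ is (isomorphic to) a submodule of a flat $R$-module for any pair of injective $R$-modules $B$ and $C$. Integral domains are commutative. A ring is right perfect if every flat right module is projective. *)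

(* Defs.v *)
From HB Require Import structures.
From mathcomp Require Import all_boot all_algebra.
From mathcomp Require Import boolp.
From mathcomp.multinomials Require Import freeg.

Set Implicit Arguments.
Unset Strict Implicit.
Unset Printing Implicit Defensive.

Import GRing.Theory.
Local Open Scope ring_scope.
Local Open Scope quotient_scope.

(* A right R-module is a left module over the converse ring R^c, with the
   action m . r written (r : R^c) *: m, so that R as a right module over
   itself is R^c^o and its submodules are the right ideals of R. Over a
   commutative ring, where the two sides agree, "R-module" is also rendered
   by lmodType R^c. Rings are of type pzRingType: the zero ring is allowed. *)

Section Modules.
Variable A : pzRingType.
Implicit Types M N P E : lmodType A.

Definition finitely_generated M : Prop :=
  exists (n : nat) (g : 'I_n -> M),
    forall x : M, exists c : 'I_n -> A, x = \sum_(i < n) c i *: g i.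

Definition finitely_presented M : Prop :=
  exists (m n : nat) (f : {linear 'rV[A]_m -> 'rV[A]_n})
         (g : {linear 'rV[A]_n -> M}),
    (forall x, exists v, g v = x) /\
    (forall v, g v = 0 <-> exists u, f u = v).

Definition is_basis M (B : {pred M}) : Prop :=
  (forall x : M, exists (s : seq M) (c : M -> A),
     {subset s <= B} /\ x = \sum_(b <- s) c b *: b) /\
  (forall (s : seq M) (c : M -> A), uniq s -> {subset s <= B} ->
     \sum_(b <- s) c b *: b = 0 -> {in s, forall b, c b = 0}).

Definition free_module M : Prop := exists B : {pred M}, is_basis B.

Definition projective_module P : Prop :=
  forall M N (g : {linear M -> N}) (f : {linear P -> N}),
    (forall y, exists x, g x = y) ->
    exists h : {linear P -> M}, forall x, g (h x) = f x.

Definition injective_module E : Prop :=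
  forall M N (i : {linear M -> N}) (f : {linear M -> E}),
    injective i -> exists h : {linear N -> E}, forall x, h (i x) = f x.

End Modules.

Section TensorProduct.
Variables (R : pzRingType) (M : lmodType R^c) (N : lmodType R).

Local Notation FMN := {freeg (M * N) / int}.

(* The subgroup by which the free abelian group on M x N is divided to obtain
   M (x) N; in freeg, << p >> is the generator attached to p. *)
Inductive tensor_relations : FMN -> Prop :=
| TensorRel0 : tensor_relations 0
| TensorRelB z z' of tensor_relations z & tensor_relations z' :
    tensor_relations (z - z')
| TensorRelDl m m' n :
    tensor_relations (<< (m + m', n) >> - << (m, n) >> - << (m', n) >>)
| TensorRelDr m n n' :
    tensor_relations (<< (m, n + n') >> - << (m, n) >> - << (m, n') >>)
| TensorRelZ m (r : R) n :
    tensor_relations (<< ((r : R^c) *: m, n) >> - << (m, r *: n) >>).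

Definition tensor_relb : {pred FMN} := fun z => `[< tensor_relations z >].

Lemma tensor_relb_zmod_closed : zmod_closed tensor_relb.
Proof.
split=> [|x y /asboolP Rx /asboolP Ry]; apply/asboolP.
  exact: TensorRel0.
exact: TensorRelB.
Qed.

HB.instance Definition _ :=
  GRing.isZmodClosed.Build FMN tensor_relb tensor_relb_zmod_closed.

Definition tensor := Quotient.quot tensor_relb.

HB.instance Definition _ := Quotient.on tensor.
HB.instance Definition _ := GRing.Zmodule.on tensor.

Definition pure_tensor (m : M) (n : N) : tensor :=
  \pi_tensor (<< (m, n) >> : FMN).

Lemma tensor_piP (z z' : FMN) :
  \pi_tensor z = \pi_tensor z' <-> tensor_relations (z - z').
Proof.
split=> [/eqP|Rz].
  by rewrite -Quotient.idealrBE => /asboolP.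
by apply/eqP; rewrite -Quotient.idealrBE; apply/asboolP.
Qed.

Lemma tensor_piB (z z' : FMN) :
  \pi_tensor (z - z') = \pi_tensor z - \pi_tensor z' :> tensor.
Proof. exact: (raddfB \pi_(Quotient.quot tensor_relb)). Qed.

End TensorProduct.

Section TensorMap.
Variables (R : pzRingType) (M : lmodType R^c) (N N' : lmodType R).
Variable f : {linear N -> N'}.

Definition freeg_map (z : {freeg (M * N) / int}) : {freeg (M * N') / int} :=
  fglift (fun p : M * N => << (p.1, f p.2) >> : {freeg (M * N') / int}) z.

(* The morphism of abelian groups M (x) f. The choice of a representative of t
   is immaterial, see tensor_map_pi. *)
Definition tensor_map (t : tensor M N) : tensor M N' :=
  \pi_(tensor M N') (freeg_map (repr t)).

Lemma freeg_mapB : {morph freeg_map : z z' / z - z'}.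
Proof. exact: lift_is_additive. Qed.

Lemma freeg_mapU p : freeg_map << p >> = << (p.1, f p.2) >>.
Proof. by rewrite /freeg_map liftU scale1r. Qed.

Lemma tensor_relations_map (z : {freeg (M * N) / int}) :
  tensor_relations z -> tensor_relations (freeg_map z).
Proof.
elim=> [|z1 z2 _ R1 _ R2|m m' n|m n n'|m r n]; last 3 first.
- by rewrite !freeg_mapB !freeg_mapU; apply: TensorRelDl.
- by rewrite !freeg_mapB !freeg_mapU /= linearD; apply: TensorRelDr.
- by rewrite !freeg_mapB !freeg_mapU /= linearZ; apply: TensorRelZ.
- by rewrite -(subr0 0) freeg_mapB subrr; apply: TensorRel0.
- by rewrite freeg_mapB; apply: TensorRelB.
Qed.

Lemma tensor_map_pi (z : {freeg (M * N) / int}) :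
  tensor_map (\pi_(tensor M N) z) = \pi_(tensor M N') (freeg_map z).
Proof.
apply/tensor_piP; rewrite -freeg_mapB; apply: tensor_relations_map.
by apply/tensor_piP; rewrite reprK.
Qed.

Lemma tensor_map_pure m n : tensor_map (pure_tensor m n) = pure_tensor m (f n).
Proof. by rewrite tensor_map_pi freeg_mapU. Qed.

Lemma tensor_mapB : {morph tensor_map : t t' / t - t'}.
Proof.
move=> t t'; rewrite -[t]reprK -[t']reprK -tensor_piB !tensor_map_pi.
by rewrite freeg_mapB tensor_piB.
Qed.

End TensorMap.

(* M (x) _ is always right exact, so exactness is preservation of injections. *)
Definition flat_module (R : pzRingType) (M : lmodType R^c) : Prop :=
  forall (N N' : lmodType R) (f : {linear N -> N'}),
    injective f -> injective (@tensor_map R M N N' f).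

Section Hom.
Variables (A : comPzRingType) (B C : lmodType A).

(* A copy of {linear B -> C}, made a module for the pointwise operations. *)
Definition hom := {linear B -> C}.

HB.instance Definition _ := gen_eqMixin hom.
HB.instance Definition _ := gen_choiceMixin hom.

Definition hom_zero : hom := \0.
Definition hom_add (f g : hom) : hom := f \+ g.
Definition hom_opp (f : hom) : hom := \- f.
Definition hom_scale (a : A) (f : hom) : hom := a \*: f.

Lemma homP (f g : hom) : (forall x, f x = g x) -> f = g.
Proof.
case: f g => [f cf] [g cg] /= /funext fg; move: cg; rewrite -{}fg => cg.
congr GRing.Linear.Pack; case: cf cg => [[?] [?]] [[?] [?]].
by congr (GRing.Linear.Class _ _); congr (_ _); exact: Prop_irrelevance.
Qed.

Lemma hom_addA : associative hom_add.
Proof. by move=> f g h; apply: homP => x; apply: addrA. Qed.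

Lemma hom_addC : commutative hom_add.
Proof. by move=> f g; apply: homP => x; apply: addrC. Qed.

Lemma hom_add0 : left_id hom_zero hom_add.
Proof. by move=> f; apply: homP => x; apply: add0r. Qed.

Lemma hom_addN : left_inverse hom_zero hom_opp hom_add.
Proof. by move=> f; apply: homP => x; apply: addNr. Qed.

HB.instance Definition _ :=
  GRing.isZmodule.Build hom hom_addA hom_addC hom_add0 hom_addN.

Lemma hom_scaleA a b f : hom_scale a (hom_scale b f) = hom_scale (a * b) f.
Proof. by apply: homP => x; apply: scalerA. Qed.

Lemma hom_scale1 : left_id 1 hom_scale.
Proof. by move=> f; apply: homP => x; apply: scale1r. Qed.

Lemma hom_scaleDr : right_distributive hom_scale +%R.
Proof. by move=> a f g; apply: homP => x; apply: scalerDr. Qed.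

Lemma hom_scaleDl f : {morph hom_scale^~ f : a b / a + b}.
Proof. by move=> a b; apply: homP => x; apply: scalerDl. Qed.

HB.instance Definition _ :=
  GRing.Zmodule_isLmodule.Build A hom
    hom_scaleA hom_scale1 hom_scaleDr hom_scaleDl.

End Hom.

Section RightModuleConditions.
Variable R : pzRingType.

Definition right_F1fp_coherent : Prop :=
  forall (F : lmodType R^c) (S : {pred F}) (N : subLmodType S),
    free_module F -> finitely_generated N -> flat_module N ->
    finitely_presented N.

Definition right_semihereditary : Prop :=
  forall (S : {pred R^c^o}) (I : subLmodType S),
    finitely_generated I -> projective_module I.

Definition right_coherent : Prop :=
  forall (S : {pred R^c^o}) (I : subLmodType S),
    finitely_generated I -> finitely_presented I.

Definition right_noetherian : Prop :=
  forall I : nat -> {pred R^c^o},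
    (forall n, submod_closed (I n)) ->
    (forall n, {subset I n <= I n.+1}) ->
    exists n, forall m, (n <= m)%N -> I m =i I n.

Definition right_perfect : Prop :=
  forall M : lmodType R^c, flat_module M -> projective_module M.

End RightModuleConditions.

Definition semi_coherent (R : comPzRingType) : Prop :=
  forall B C : lmodType R^c, injective_module B -> injective_module C ->
    exists (F : lmodType R^c) (S : {pred F}) (N : subLmodType S)
           (phi : {linear hom B C -> N}),
      flat_module F /\ bijective phi.

(* Main.v *)
Require Import Defs.
From HB Require Import structures.
From mathcomp Require Import all_boot all_order all_algebra.
From mathcomp Require Import boolp classical_sets functions.
From mathcomp.multinomials Require Import freeg.

(* Write a finitely generated submodule N of a free module in terms of
   generators x = (x_1, ..., x_m); N is finitely presented as soon as the module
   K of relations of x is finitely generated.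

   Over a coherent (in particular Noetherian or semihereditary) ring, K is the
   left kernel of a matrix, and one eliminates the columns one at a time.

   If N is flat, then by the equational criterion every family f with
   sum_i x_i (x) f_i = 0 is killed by a matrix C such that C x = x. If killing f
   forces K C = 0, then K is generated by the rows of 1 - C. It remains to find
   such a family f.

   - Over a domain, let P be a matrix whose rows are relations of x and have
     maximal rank over the fraction field, and let f be the columns of P.

   - Over a semi-coherent ring R, put E = Hom_Z(R, Q/Z) and
     E' = Hom_Z(R, (Q/Z)^K), which is E^K. Both are injective, and R^K embeds in
     Hom_R(E, E'), hence in a flat module F. Let f_i in F be the image of the
     i-th coordinate function on K. Since N sits in a free module F0, F (x) N
     embeds in F (x) F0, where sum_i f_i (x) x_i = 0 is checked on the
     coordinates. *)

Set Implicit Arguments.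
Unset Strict Implicit.
Unset Printing Implicit Defensive.

Import Order.TTheory GRing.Theory Num.Theory.
Local Open Scope ring_scope.
Local Open Scope quotient_scope.

(** * Finite presentations and syzygies *)

Section Syzygies.
Variable A : pzRingType.

Definition lincomb (M : lmodType A) m (x : 'I_m -> M) (v : 'rV[A]_m) : M :=
  \sum_i v 0 i *: x i.

Lemma lincomb_is_linear (M : lmodType A) m (x : 'I_m -> M) :
  linear (lincomb x).
Proof.
move=> a u v; rewrite /lincomb scaler_sumr -big_split /=.
by apply: eq_bigr => i _; rewrite !mxE scalerDl scalerA.
Qed.

HB.instance Definition _ (M : lmodType A) m (x : 'I_m -> M) :=
  GRing.isLinear.Build A 'rV[A]_m M *:%R (lincomb x) (lincomb_is_linear x).

Definition spanning (M : lmodType A) m (x : 'I_m -> M) : Prop :=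
  forall y, exists v, lincomb x v = y.

Definition fg_syzygies (M : lmodType A) m (x : 'I_m -> M) : Prop :=
  exists p (U : 'M[A]_(p, m)),
    forall v, lincomb x v = 0 <-> exists w, v = w *m U.

Lemma finitely_generatedP (M : lmodType A) :
  finitely_generated M <-> exists m (x : 'I_m -> M), spanning x.
Proof.
split=> -[m [x xM]]; exists m, x => y; have [c] := xM y.
  by move=> ->; exists (\row_i c i); apply: eq_bigr => i _; rewrite mxE.
by move=> <-; exists (c 0).
Qed.

Lemma lincomb_delta (M : lmodType A) m (x : 'I_m -> M) i :
  lincomb x (delta_mx 0 i) = x i.
Proof.
rewrite /lincomb (bigD1 i) //= mxE !eqxx scale1r big1 ?addr0 // => j ji.
by rewrite mxE eqxx (negbTE ji) scale0r.
Qed.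

Lemma lincomb_mulmx (M : lmodType A) m p (x : 'I_m -> M) w
    (U : 'M[A]_(p, m)) :
  lincomb x (w *m U) = lincomb (fun i => lincomb x (row i U)) w.
Proof.
rewrite mulmx_sum_row linear_sum.
by apply: eq_bigr => i _; rewrite linearZ_LR.
Qed.

Lemma linear_lincomb (M N : lmodType A) (f : {linear M -> N}) m
    (x : 'I_m -> M) v :
  f (lincomb x v) = lincomb (f \o x) v.
Proof. by rewrite linear_sum; apply: eq_bigr => i _; rewrite linearZ_LR. Qed.

Lemma linear_rV (M : lmodType A) m (f : {linear 'rV[A]_m -> M}) v :
  f v = lincomb (fun i => f (delta_mx 0 i)) v.
Proof.
rewrite {1}[v]row_sum_delta linear_sum.
by apply: eq_bigr => i _; rewrite linearZ_LR.
Qed.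

Lemma spanning_rV (M : lmodType A) m n (x : 'I_m -> M) (y : 'I_n -> M) :
  spanning x ->
  exists U : 'M[A]_(n, m), forall w, lincomb x (w *m U) = lincomb y w.
Proof.
move=> xM; have /choice[g gP] i := xM (y i).
exists (\matrix_i g i) => w; rewrite lincomb_mulmx.
by congr lincomb; apply/funext => i; rewrite rowK gP.
Qed.

Lemma fg_syzygies_fp (M : lmodType A) m (x : 'I_m -> M) :
  spanning x -> fg_syzygies x -> finitely_presented M.
Proof.
move=> xM [p [U UP]].
exists p, m, (mulmxr U : {linear _ -> _}), (lincomb x : {linear _ -> _}).
by split=> // v; rewrite UP; split=> -[w]; exists w.
Qed.

(* Schanuel's trick: [x] and the generators of a finite presentation express
   each other through matrices [a] and [b]. *)
Lemma fp_fg_syzygies (M : lmodType A) m (x : 'I_m -> M) :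
  spanning x -> finitely_presented M -> fg_syzygies x.
Proof.
move=> xM [p [n [f [g [gM fg]]]]].
have [b bP] := spanning_rV (fun j => g (delta_mx 0 j)) xM.
have [a aP] : exists a : 'M[A]_(m, n), forall w, g (w *m a) = lincomb x w.
  have gS : spanning (fun j => g (delta_mx 0 j)).
    by move=> y; have [v <-] := gM y; exists v; rewrite -linear_rV.
  have [a aP] := spanning_rV x gS.
  by exists a => w; rewrite linear_rV aP.
have bP' v : lincomb x (v *m b) = g v by rewrite bP -linear_rV.
(* A syzygy v is v (1 - a b) + (v a) b, where v a is a relation of the presentation, hence in the
   image of [f]. *)
exists (m + p)%N, (col_mx (1%:M - a *m b) (lin1_mx f *m b)) => v; split.
  rewrite -aP => /fg[u fu]; exists (row_mx v u); rewrite mul_row_col.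
  by rewrite mulmxBr mulmx1 !mulmxA -fu mul_rV_lin1 subrK.
move=> [w ->]; rewrite -[w]hsubmxK mul_row_col !mulmxA linearD /= !bP'.
rewrite mul_rV_lin1 mulmxBr mulmx1 mulmxA linearB /= bP' aP subrr add0r.
by apply/fg; exists (rsubmx w).
Qed.

Lemma fg_syzygies_retract (M : lmodType A) m (x : 'I_m -> M) (C : 'M[A]_m) :
  (forall v, lincomb x (v *m C) = lincomb x v) ->
  (forall v, lincomb x v = 0 -> v *m C = 0) ->
  fg_syzygies x.
Proof.
move=> xC KC; exists m, (1%:M - C) => v; split=> [/KC vC|[w ->]].
  by exists v; rewrite mulmxBr vC subr0 mulmx1.
by rewrite mulmxBr mulmx1 linearB /= xC subrr.
Qed.

(** Projectivity splits the surjection [lincomb x]. For a section [h], the matrix of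
    [h \o lincomb x] preserves combinations of [x] and kills syzygies, so [fg_syzygies_retract]
    applies. *)
Lemma projective_fg_fp (M : lmodType A) :
  finitely_generated M -> projective_module M -> finitely_presented M.
Proof.
move=> /finitely_generatedP[m [x xM]] projM; apply: (fg_syzygies_fp xM).
have [h hP] := projM _ _ (lincomb x : {linear _ -> _})
  (idfun : {linear M -> M}) xM.
have hE v : v *m lin1_mx (h \o lincomb x) = h (lincomb x v).
  by rewrite mul_rV_lin1.
by apply: (@fg_syzygies_retract _ _ _ (lin1_mx (h \o lincomb x))) => v;
  rewrite hE ?hP // => ->; rewrite linear0.
Qed.

Definition left_kernel_fg m n (X : 'M[A]_(m, n)) : Prop :=
  exists p (U : 'M[A]_(p, m)),
    forall v : 'rV_m, v *m X = 0 <-> exists w, v = w *m U.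

(** If the rows of [U] generate the kernel of the first column [X1], then w U is killed by the other
    columns [X2] exactly when w is in the kernel of [U *m X2], which has one column fewer. *)
Lemma left_kernel_fg_col :
  (forall m (X : 'M[A]_(m, 1)), left_kernel_fg X) ->
  forall m n (X : 'M[A]_(m, n)), left_kernel_fg X.
Proof.
move=> fg1 m n; elim: n m => [|n IHn] m X.
  exists m, 1%:M => v; split=> _; first by exists v; rewrite mulmx1.
  by rewrite [LHS]thinmx0.
suff {X} : forall X : 'M[A]_(m, 1 + n), left_kernel_fg X by apply.
move=> X; rewrite -[X]hsubmxK; move: (lsubmx _) (rsubmx _) => X1 X2.
have [p [U UP]] := fg1 m X1.
have [q [W WP]] := IHn p (U *m X2); exists q, (W *m U) => v.
rewrite mul_mx_row -row_mx0; split=> [/eq_row_mx[/UP[w ->]]|[u ->]].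
  by rewrite -mulmxA => /WP[u ->]; exists u; rewrite mulmxA.
congr row_mx; first by apply/UP; exists (u *m W); rewrite mulmxA.
by rewrite mulmxA -mulmxA; apply/WP; exists u.
Qed.

End Syzygies.

(** * Finitely generated submodules *)

Section Span.
Variables (A : pzRingType) (M : lmodType A) (m : nat) (x : 'I_m -> M).

Definition in_span : {pred M} := fun y => `[< exists v, lincomb x v = y >].

Lemma in_span_submod_closed : submod_closed in_span.
Proof.
split=> [|a y z /asboolP[v <-] /asboolP[w <-]]; apply/asboolP.
  by exists 0; rewrite linear0.
by exists (a *: v + w); rewrite linearP.
Qed.

HB.instance Definition _ :=
  GRing.isSubmodClosed.Build A M in_span in_span_submod_closed.

(** The span as a module in its own right serves twice: coherence speaks of a [subLmodType], and the
    vanishing criterion for tensors needs a module generated by the given family. *)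
Definition span_module := {y : M | y \in in_span}.
HB.instance Definition _ := SubChoice.on span_module.
HB.instance Definition _ := [SubChoice_isSubLmodule of span_module by <:].

Lemma mem_span i : x i \in in_span.
Proof. by apply/asboolP; exists (delta_mx 0 i); rewrite lincomb_delta. Qed.

Definition span_gen i : span_module := Sub (x i) (mem_span i).

Lemma val_lincomb_span v : val (lincomb span_gen v) = lincomb x v.
Proof. by rewrite linear_lincomb. Qed.

Lemma spanning_span : spanning span_gen.
Proof.
move=> [y ys]; have /asboolP[v vy] := ys; exists v; apply: val_inj.
by rewrite val_lincomb_span.
Qed.

Lemma lincomb_span_eq0 v : lincomb span_gen v = 0 <-> lincomb x v = 0.
Proof.
rewrite -val_lincomb_span.
by split=> [->|v0]; [|apply: val_inj]; rewrite ?raddf0.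
Qed.

End Span.

(** * Coordinates in free modules *)

Lemma big_mem_uniq (V : nmodType) (I : eqType) (s t : seq I) (f : I -> V) :
  uniq t -> {subset s <= t} ->
  \sum_(i <- s) f i = \sum_(j <- t) \sum_(i <- s | i == j) f i.
Proof.
move=> ut st; rewrite (exchange_big_dep predT) //= big_seq [RHS]big_seq.
apply: eq_bigr => i /st it.
rewrite (eq_bigl (pred1 i)) => [|j]; last by rewrite /= eq_sym.
by rewrite -big_filter filter_pred1_uniq // big_seq1.
Qed.

Lemma big_seq_ord (V : nmodType) (I : Type) (x0 : I) (t : seq I) (f : I -> V) :
  \sum_(j <- t) f j = \sum_(l < size t) f (nth x0 t l).
Proof. by rewrite (big_nth x0) big_mkord. Qed.

Lemma free_module_coordinates (A : pzRingType) (F : lmodType A) m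
    (y : 'I_m -> F) :
  free_module F ->
  exists n (b : 'I_n -> F) (X : 'M[A]_(m, n)),
    (forall i, y i = lincomb b (row i X)) /\
    (forall v, lincomb b v = 0 -> v = 0).
Proof.
move=> [B [Bgen Bfree]].
have /choice[s] i := Bgen (y i); move=> /choice[c sc].
(* [t] lists once each basis element that some expansion uses; repetitions inside [s i] are merged
   in the coefficients of the matrix. *)
pose t := undup (flatten [seq s i | i <- enum 'I_m]).
have st i : {subset s i <= t}.
  move=> b bs; rewrite mem_undup; apply/flattenP; exists (s i) => //.
  by apply: map_f; rewrite mem_enum.
have tB : {subset t <= B}.
  move=> b; rewrite mem_undup => /flattenP[_ /mapP[i _ ->]].
  exact: (sc i).1.
have ut : uniq t by exact: undup_uniq.
exists (size t), (fun l => nth 0 t l).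
exists (\matrix_(i, l) \sum_(b <- s i | b == nth 0 t l) c i b).
split=> [i|v v0].
  rewrite (sc i).2 (big_mem_uniq _ ut (st i)) (big_seq_ord 0) /lincomb.
  apply: eq_bigr => l _; rewrite !mxE scaler_suml.
  by apply: eq_bigr => b /eqP <-.
(* Independence of [B] concerns coefficient functions on all of [F], so [v] is read through
   positions in [t], with default 0 elsewhere. *)
pose d b := if insub (index b t) is Some l then v 0 l else 0.
have dE (l : 'I_(size t)) : d (nth 0 t l) = v 0 l.
  by rewrite /d index_uniq // valK.
have d0 : {in t, forall b, d b = 0}.
  apply: Bfree => //; rewrite (big_seq_ord 0); apply: etrans v0.
  by apply: eq_bigr => l _; rewrite dE.
by apply/rowP => l; rewrite -dE d0 ?mxE // mem_nth.
Qed.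

Lemma sub_free_coordinates (A : pzRingType) (F : lmodType A) (S : {pred F})
    (N : subLmodType S) m (x : 'I_m -> N) :
  free_module F ->
  exists n (b : 'I_n -> F) (X : 'M[A]_(m, n)),
    (forall i, val (x i) = lincomb b (row i X)) /\
    (forall v, lincomb x v = 0 <-> v *m X = 0).
Proof.
move=> /(free_module_coordinates (val \o x))[n [b [X [xX b_free]]]].
exists n, b, X; split=> // v.
have vx : val (lincomb x v) = lincomb b (v *m X).
  by rewrite linear_lincomb lincomb_mulmx; congr lincomb; apply/funext => i.
split=> v0; first by apply: b_free; rewrite -vx v0 raddf0.
by apply: val_inj; rewrite vx v0 !linear0.
Qed.

(** * Coherent, semihereditary and perfect rings *)

Lemma left_kernel_fg_F1fp (R : pzRingType) :
  (forall m n (X : 'M[R^c]_(m, n)), left_kernel_fg X) -> right_F1fp_coherent R.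
Proof.
move=> kerR F S N Ffree /finitely_generatedP[m [x xN]] _.
have [n [b [X [_ kerX]]]] := sub_free_coordinates x Ffree.
have [p [U UP]] := kerR _ _ X.
by apply: (fg_syzygies_fp xN); exists p, U => v; rewrite kerX.
Qed.

(** The left kernel of a single column is the syzygy module of the right ideal generated by its
    entries. Coherence presents this ideal, and [fp_fg_syzygies] transfers the presentation to these
    generators. *)
Lemma coherent_F1fp (R : pzRingType) :
  right_coherent R -> right_F1fp_coherent R.
Proof.
move=> cohR; apply: left_kernel_fg_F1fp; apply: left_kernel_fg_col => m X.
pose x i : R^c^o := X i 0.
have gensp := @spanning_span _ _ _ x.
have fgI : finitely_generated (span_module x).
  by apply/finitely_generatedP; exists m, (span_gen x).
have [p [U UP]] := fp_fg_syzygies gensp (cohR _ _ fgI).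
exists p, U => v; rewrite -UP lincomb_span_eq0.
have -> : lincomb x v = (v *m X) 0 0 by rewrite mxE.
by split=> [->|vX]; [rewrite mxE|apply/rowP=> i; rewrite ord1 vX mxE].
Qed.

Lemma semihereditary_coherent (R : pzRingType) :
  right_semihereditary R -> right_coherent R.
Proof. by move=> shR S I fgI; apply: projective_fg_fp (shR _ _ fgI). Qed.

Lemma perfect_F1fp (R : pzRingType) : right_perfect R -> right_F1fp_coherent R.
Proof. by move=> pR F S N _ fgN /pR; apply: projective_fg_fp. Qed.

(** * Noetherian rings *)

Lemma lincomb_mem (A : pzRingType) (M : lmodType A) (S : submodClosed M) m
    (x : 'I_m -> M) v :
  (forall i, x i \in S) -> lincomb x v \in S.
Proof. by move=> xS; apply: rpred_sum => i _; apply: rpredZ. Qed.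

(** Otherwise, repeatedly adjoining an element of [I] outside the current span yields a chain of
    spans that never becomes stationary. *)
Lemma noetherian_left_ideal_fg (R : pzRingType) (I : {pred R^c^o}) :
  right_noetherian R -> submod_closed I ->
  exists p (x : 'I_p -> R^c^o), I =i in_span x.
Proof.
move=> noethR I_sub.
pose Ihb := GRing.isSubmodClosed.Build R^c R^c^o I I_sub.
pose I' : submodClosed R^c^o := HB.pack I Ihb.
apply: contrapT => notfg.
have /choice[next nextP] (s : seq R^c^o) : exists y, {subset s <= I} ->
    y \in I /\ y \notin in_span (tnth (in_tuple s)).
  case: (pselect {subset s <= I}) => [sI|]; last by exists 0.
  apply: contrapT => nosuch; apply: notfg; exists (size s), (tnth (in_tuple s)).
  move=> y; apply/idP/idP => [yI|/asboolP[v <-]].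
    by apply: contrapT => /negP ys; apply: nosuch; exists y.
  by apply: (@lincomb_mem _ _ I') => i; apply/sI/mem_tnth.
pose s n := iter n (fun s => rcons s (next s)) [::].
have sI n : {subset s n <= I}.
  elim: n => [|n IHn] y //=; rewrite mem_rcons inE => /predU1P[->|/IHn//].
  by case: (nextP _ IHn).
have in_spanS n y : y \in s n -> y \in in_span (tnth (in_tuple (s n))).
  by move=> ys; have /tnthP[i ->] : y \in in_tuple (s n) by []; apply: mem_span.
have [|n y|n stat] := noethR (fun n => in_span (tnth (in_tuple (s n)))).
- by move=> n; exact: in_span_submod_closed.
- move=> /asboolP[v <-]; apply: lincomb_mem => i; apply: in_spanS.
  by rewrite /= mem_rcons inE mem_tnth orbT.
case: (nextP _ (sI n)) => _ /negP; apply; rewrite -(stat n.+1) //.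
by apply: in_spanS; rewrite /= mem_rcons mem_head.
Qed.

(** Induction on the number of coordinates. The first coordinates of [K] form an ideal [I], and the
    elements with first coordinate 0 a submodule of a shorter row space. Subtracting a combination
    of lifts of generators of [I] clears the first coordinate, so these lifts and generators of the
    submodule together generate [K]. *)
Lemma noetherian_row_submodule_fg (R : pzRingType) m (K : {pred 'rV[R^c]_m}) :
  right_noetherian R -> submod_closed K ->
  exists p (U : 'M[R^c]_(p, m)), forall v, v \in K <-> exists w, v = w *m U.
Proof.
move=> noethR; elim: m K => [|m IHm] K K_sub.
  exists 0%N, 0 => v; split=> _; first by exists 0; rewrite [LHS]thinmx0 mulmx0.
  by rewrite (thinmx0 v); have [] := K_sub.
suff {K K_sub} : forall K : {pred 'rV[R^c]_(1 + m)}, submod_closed K ->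
    exists p (U : 'M[R^c]_(p, 1 + m)),
      forall v, v \in K <-> exists w, v = w *m U.
  by apply.
move=> K K_sub; have [K0 KP] := K_sub.
pose Khb := GRing.isSubmodClosed.Build R^c 'rV[R^c]_(1 + m) K K_sub.
pose K' : submodClosed 'rV[R^c]_(1 + m) := HB.pack K Khb.
pose I : {pred R^c^o} := fun a => `[< exists v, row_mx a%:M v \in K >].
have [|p [x Ix]] := @noetherian_left_ideal_fg R I noethR.
  split=> [|a b c /asboolP[v vK] /asboolP[w wK]]; apply/asboolP.
    by exists 0; rewrite raddf0 row_mx0.
  exists (a *: v + w).
  suff -> : row_mx (a *: b + c)%:M (a *: v + w) =
    a *: row_mx b%:M v + row_mx c%:M w :> 'rV_(1 + m) by exact: KP.
  by rewrite scale_row_mx add_row_mx raddfD /= scale_scalar_mx.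
have /choice[l lK] i : exists v, row_mx (x i)%:M v \in K.
  by apply/asboolP; change (x i \in I); rewrite Ix mem_span.
have [|q [U UP]] := IHm (fun v => row_mx (0 : 'M_1) v \in K).
  split=> [|a v w vK wK]; first by rewrite -topredE /= row_mx0.
  rewrite -topredE /= -(addr0 0) -{1}(scaler0 _ a).
  by rewrite -add_row_mx -scale_row_mx KP.
exists (p + q)%N, (col_mx (\matrix_i row_mx (x i)%:M (l i)) (row_mx 0 U)) => v.
have LK w : w *m (\matrix_i row_mx (x i)%:M (l i)) \in K.
  rewrite mulmx_sum_row; apply: (@rpred_sum _ K') => i _.
  by rewrite rowK; apply: (@rpredZ _ _ K').
split=> [vK|[w ->]]; last first.
  rewrite -[w]hsubmxK mul_row_col; apply: (@rpredD _ K') => //.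
  by rewrite mul_mx_row mulmx0; apply/UP; exists (rsubmx w).
have /asboolP[c cv] : lsubmx v 0 0 \in in_span x.
  rewrite -Ix; apply/asboolP; exists (rsubmx v).
  by rewrite -mx11_scalar hsubmxK.
have vcK : v - c *m (\matrix_i row_mx (x i)%:M (l i)) \in K.
  by rewrite -scaleN1r; apply: (@rpredD _ K') => //; apply: (@rpredZ _ _ K').
set t := v - _ in vcK.
have lt : lsubmx t = 0.
  apply/rowP => i; rewrite ord1 !mxE; move: cv; rewrite mxE => <-.
  apply/eqP; rewrite subr_eq0.
  by apply/eqP/eq_bigr => j _; rewrite mxE row_mxEl mxE eqxx.
have /UP[u tu] : rsubmx t \in (fun v => row_mx (0 : 'M_1) v \in K).
  by rewrite -topredE /= -lt hsubmxK.
exists (row_mx c u); rewrite mul_row_col mul_mx_row mulmx0 -tu -lt hsubmxK.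
by rewrite addrC subrK.
Qed.

Lemma noetherian_F1fp (R : pzRingType) :
  right_noetherian R -> right_F1fp_coherent R.
Proof.
move=> noethR; apply: left_kernel_fg_F1fp => m n X.
have [|p [U UP]] :=
  @noetherian_row_submodule_fg R m (fun v => v *m X == 0) noethR.
  split=> [|a v w]; rewrite -!topredE /= ?mul0mx // => /eqP vX /eqP wX.
  by apply/eqP; rewrite mulmxDl -scalemxAl vX wX scaler0 addr0.
by exists p, U => v; rewrite -UP -topredE; split=> /eqP.
Qed.

(** * Tensor products and the equational criterion of flatness *)

Section TensorFacts.
Variables (R : pzRingType) (M : lmodType R^c) (N : lmodType R).

Lemma pure_tensorDl m m' n :
  pure_tensor (m + m') n = pure_tensor m n + pure_tensor m' n :> tensor M N.
Proof.
rewrite /pure_tensor -(raddfD \pi_(Quotient.quot (@tensor_relb R M N))).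
by apply/tensor_piP; rewrite opprD addrA; apply: TensorRelDl.
Qed.

Lemma pure_tensorDr m n n' :
  pure_tensor m (n + n') = pure_tensor m n + pure_tensor m n' :> tensor M N.
Proof.
rewrite /pure_tensor -(raddfD \pi_(Quotient.quot (@tensor_relb R M N))).
by apply/tensor_piP; rewrite opprD addrA; apply: TensorRelDr.
Qed.

Lemma pure_tensorZ (m : M) (r : R) (n : N) :
  pure_tensor ((r : R^c) *: m) n = pure_tensor m (r *: n).
Proof. exact/tensor_piP/TensorRelZ. Qed.

Lemma pure_tensor0l n : pure_tensor 0 n = 0 :> tensor M N.
Proof.
by apply: (addrI (pure_tensor (0 : M) n)); rewrite -pure_tensorDl !addr0.
Qed.

Lemma pure_tensor_suml (I : Type) (s : seq I) (x : I -> M) (n : N) :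
  pure_tensor (\sum_(i <- s) x i) n = \sum_(i <- s) pure_tensor (x i) n.
Proof.
apply: (big_morph (fun m : M => pure_tensor m n)) => [m m'|].
  exact: pure_tensorDl.
exact: pure_tensor0l.
Qed.

Lemma pure_tensor_sumr (I : Type) (s : seq I) (m : M) (y : I -> N) :
  pure_tensor m (\sum_(i <- s) y i) = \sum_(i <- s) pure_tensor m (y i).
Proof.
apply: (big_morph (@pure_tensor R M N m)) => [n n'|].
  exact: pure_tensorDr.
by apply: (addrI (pure_tensor m (0 : N))); rewrite -pure_tensorDr !addr0.
Qed.

Definition balanced (V : zmodType) (b : M -> N -> V) : Prop :=
  [/\ forall m m' n, b (m + m') n = b m n + b m' n,
      forall m n n', b m (n + n') = b m n + b m n'
    & forall m (r : R) n, b ((r : R^c) *: m) n = b m (r *: n)].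

(** The part of the universal property of the tensor product that the proof uses: the additive
    extension of [b] to the free abelian group kills [tensor_relations]. *)
Lemma balanced_sum_eq0 (V : zmodType) (b : M -> N -> V) p (x : 'I_p -> M)
    (y : 'I_p -> N) :
  balanced b -> \sum_i pure_tensor (x i) (y i) = 0 -> \sum_i b (x i) (y i) = 0.
Proof.
move=> [bDl bDr bZ].
(* [zmodule V] is [V] viewed as a module over the integers, the kind of target that [fglift]
   takes. *)
pose lift z := fglift (fun p : M * N => b p.1 p.2 : zmodule V) z.
have liftB : {morph lift : z z' / z - z'} by exact: lift_is_additive.
have liftU q : lift << q >> = b q.1 q.2 by rewrite /lift liftU scale1r.
have lift0 : lift 0 = 0 by rewrite -(subrr 0) liftB subrr.
have lift_rel z : tensor_relations z -> lift z = 0.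
  elim=> [|z1 z2 _ z10 _ z20|m m' n|m n n'|m r n] //.
  - by rewrite liftB z10 z20 subrr.
  - by rewrite !liftB !liftU bDl addrAC addrK subrr.
  - by rewrite !liftB !liftU bDr addrAC addrK subrr.
  - by rewrite !liftB !liftU bZ subrr.
pose liftHB := GRing.isZmodMorphism.Build _ (zmodule V) lift liftB.
pose lift_add : {additive {freeg (M * N) / int} -> zmodule V} :=
  HB.pack lift liftHB.
rewrite -(raddf_sum \pi_(Quotient.quot (@tensor_relb R M N))).
rewrite -(raddf0 \pi_(Quotient.quot (@tensor_relb R M N))).
move=> /tensor_piP/lift_rel.
rewrite subr0 -[lift _]/(lift_add _) raddf_sum => b0.
by rewrite -[RHS]b0; apply: eq_bigr => i _; rewrite /= liftU.
Qed.

End TensorFacts.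

HB.instance Definition _ (R : pzRingType) (M : lmodType R^c) (N N' : lmodType R)
    (f : {linear N -> N'}) :=
  GRing.isZmodMorphism.Build (tensor M N) (tensor M N') (tensor_map f)
    (tensor_mapB f).

(** * Vanishing of sums of pure tensors *)

Section VanishingCriterion.
Variables (R : pzRingType) (N : lmodType R^c) (G : lmodType R) (m : nat).
Variables (x : 'I_m -> N) (g : 'I_m -> G).

Definition killing_matrix (C : 'M[R^c]_m) : Prop :=
  forall k, \sum_i (C i k : R) *: g i = 0.

Definition killed_image : {pred {ffun 'I_m -> N}} := fun v =>
  `[< exists C, killing_matrix C /\ v = [ffun i => lincomb x (row i C)] >].

Lemma killed_image_zmod_closed : zmod_closed killed_image.
Proof.
split=> [|_ _ /asboolP[C [C0 ->]] /asboolP[D [D0 ->]]]; apply/asboolP.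
  exists 0; split=> [k|].
    by rewrite big1 // => i _; rewrite mxE scale0r.
  by apply/ffunP => i; rewrite !ffunE row0 linear0.
exists (C - D); split=> [k|].
  transitivity (\sum_i (C i k : R) *: g i - \sum_i (D i k : R) *: g i).
    by rewrite -sumrB; apply: eq_bigr => i _; rewrite !mxE -scalerBl.
  by rewrite C0 D0 subrr.
by apply/ffunP => i; rewrite !ffunE !linearB.
Qed.

HB.instance Definition _ :=
  GRing.isZmodClosed.Build {ffun 'I_m -> N} killed_image
    killed_image_zmod_closed.

Let Q := Quotient.quot killed_image.

Hypothesis xN : spanning x.

(** For y = sum_k b_k x_k, the killing matrix is the outer product of [a] and b: each of its columns
    is a multiple of the relation [a]. *)
Lemma killed_image_relation (a : 'rV[R]_m) y :
  lincomb g a = 0 -> [ffun i => (a 0 i : R^c) *: y] \in killed_image.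
Proof.
move=> a0; have [b <-] := xN y; apply/asboolP.
exists (\matrix_(i, k) ((a 0 i : R^c) * b 0 k)); split=> [k|].
  transitivity ((b 0 k : R) *: lincomb g a); last by rewrite a0 scaler0.
  by rewrite scaler_sumr; apply: eq_bigr => i _; rewrite mxE scalerA.
apply/ffunP => i; rewrite !ffunE -linearZ; congr lincomb.
by apply/rowP => k; rewrite !mxE.
Qed.

Hypothesis gG : spanning g.

(* The map b (y, sum_i a_i g_i) = class of (y a_i)_i is well defined and
   balanced, and sends sum_i x_i (x) g_i to the class of x. *)
Lemma vanishing_criterion :
  \sum_i pure_tensor (x i) (g i) = 0 ->
  exists C, killing_matrix C /\ forall i, lincomb x (row i C) = x i.
Proof.
have /choice[coef coefP] := gG.
pose w (a : 'rV[R]_m) y : {ffun 'I_m -> N} := [ffun i => (a 0 i : R^c) *: y].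
(* Modulo [killed_image], [w a y] depends on [a] only through [lincomb g a]. So the map [b] below is
   additive although the choice [coef] need not be. *)
have wP (a a' : 'rV[R]_m) y : lincomb g a = lincomb g a' ->
    \pi_Q (w a y) = \pi_Q (w a' y).
  move=> aa'; apply/eqP; rewrite -Quotient.idealrBE.
  have -> : w a y - w a' y = w (a - a') y.
    by apply/ffunP => i; rewrite !ffunE !mxE -scalerBl.
  by apply: killed_image_relation; rewrite linearB /= aa' subrr.
have piD : {morph \pi_Q : v v' / v + v'}.
  exact: (raddfD \pi_(Quotient.quot killed_image)).
have pi0 : \pi_Q 0 = 0 by exact: (raddf0 \pi_(Quotient.quot killed_image)).
pose b y u : Q := \pi_Q (w (coef u) y).
have bal : balanced b.
  split=> [y y' u|y u u'|y r u].
  - rewrite -piD; congr (\pi_Q _).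
    by apply/ffunP => i; rewrite !ffunE scalerDr.
  - rewrite -piD /b (wP _ (coef u + coef u')) ?linearD /= ?coefP //.
    by congr (\pi_Q _); apply/ffunP => i; rewrite !ffunE mxE -scalerDl.
  - rewrite /b (wP (coef (r *: u)) (r *: coef u)) ?linearZ /= ?coefP //.
    by congr (\pi_Q _); apply/ffunP => i; rewrite !ffunE mxE scalerA.
move=> /(balanced_sum_eq0 bal).
have -> : \sum_i b (x i) (g i) = \pi_Q [ffun i => x i].
  rewrite (eq_bigr (fun i => \pi_Q (w (delta_mx 0 i) (x i)))) => [|i _];
    last by apply: wP; rewrite coefP lincomb_delta.
  rewrite -(big_morph _ piD pi0); congr (\pi_Q _); apply/ffunP => i.
  rewrite sum_ffunE ffunE (bigD1 i) //= big1 => [|j ji]; rewrite ffunE mxE eqxx.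
    by rewrite eqxx scale1r addr0.
  by rewrite eq_sym (negbTE ji) scale0r.
rewrite -pi0 => /eqP; rewrite -Quotient.idealrBE subr0 => /asboolP[C [C0 xC]].
by exists C; split=> // i; move/ffunP/(_ i): xC; rewrite !ffunE.
Qed.

End VanishingCriterion.

(** The vanishing criterion needs [f] to be spanning, so the relation is pulled back to [N] tensor
    the span of [f], which by flatness embeds in [N] tensor [F]. *)
Lemma flat_equational_criterion (R : pzRingType) (N : lmodType R^c)
    (F : lmodType R) m (x : 'I_m -> N) (f : 'I_m -> F) :
  flat_module N -> spanning x -> \sum_i pure_tensor (x i) (f i) = 0 ->
  exists C, killing_matrix f C /\ forall i, lincomb x (row i C) = x i.
Proof.
move=> flatN xN xf0.
have [|C [C0 xC]] := vanishing_criterion xN (@spanning_span _ _ _ f).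
  apply: (flatN _ _ (\val : {linear span_module f -> F}) val_inj).
  rewrite raddf0 raddf_sum -[RHS]xf0.
  by apply: eq_bigr => i _; rewrite /= tensor_map_pure.
exists C; split=> // k; have /(congr1 val) := C0 k.
by rewrite raddf_sum.
Qed.

Lemma flat_fp_of_tensor_relation (R : pzRingType) (N : lmodType R^c)
    (F : lmodType R) m (x : 'I_m -> N) (f : 'I_m -> F) :
  flat_module N -> spanning x -> \sum_i pure_tensor (x i) (f i) = 0 ->
  (forall C, killing_matrix f C -> forall v, lincomb x v = 0 -> v *m C = 0) ->
  finitely_presented N.
Proof.
move=> flatN xN xf0 fC.
have [C [C0 xC]] := flat_equational_criterion flatN xN xf0.
apply: (fg_syzygies_fp xN).
apply: (@fg_syzygies_retract _ _ _ _ C) (fC C C0) => v.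
by rewrite lincomb_mulmx; congr lincomb; apply/funext.
Qed.

(** * Integral domains *)

(** Take [P] of maximal rank over the fraction field. Appending a row v from [K] cannot raise the
    rank, so v is a combination of the rows of [P] over that field, and P C = 0 forces v C = 0. *)
Lemma finite_rank_test (R : idomainType) m (K : 'rV[R]_m -> Prop) :
  exists p (P : 'M[R]_(p, m)), (forall i, K (row i P)) /\
    forall n (C : 'M[R]_(m, n)), P *m C = 0 -> forall v, K v -> v *m C = 0.
Proof.
pose frac p n (P : 'M[R]_(p, n)) : 'M[{fraction R}]_(p, n) :=
  map_mx (@tofrac R) P.
pose rankK r := `[< exists p (P : 'M[R]_(p, m)),
  (forall i, K (row i P)) /\ \rank (frac _ _ P) = r >].
have rank0 : exists r, rankK r.
  by exists (\rank (frac 0 m 0)); apply/asboolP; exists 0, 0; split=> // -[].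
have rank_le r : rankK r -> (r <= m)%N.
  by move=> /asboolP[p [P [_ <-]]]; apply: rank_leq_col.
case: (ex_maxnP rank0 rank_le) => r /asboolP[p [P [KP rP]]] max_r.
exists p, P; split=> // n C PC v Kv.
have le_col : (frac _ _ P <= frac _ _ (col_mx P v))%MS.
  by rewrite /frac map_col_mx -addsmxE addsmxSl.
have le_v : (frac _ _ v <= frac _ _ P)%MS.
  have : (frac _ _ (col_mx P v) <= frac _ _ P)%MS.
    rewrite -(geq_leqif (mxrank_leqif_sup le_col)) rP; apply: max_r.
    apply/asboolP; exists (p + 1)%N, (col_mx P v); split=> // i.
    case: (split_ordP i) => j ->; first by rewrite rowKu.
    by rewrite rowKd row_id.
  by apply: submx_trans; rewrite /frac map_col_mx -addsmxE addsmxSr.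
have [u uP] := submxP le_v.
have : map_mx (@tofrac R) (v *m C) = 0.
  by rewrite map_mxM -/(frac _ _ v) uP -mulmxA -map_mxM PC map_mx0 mulmx0.
move=> vC; apply/rowP => k; apply/eqP.
rewrite [X in _ == X]mxE -tofrac_eq0; apply/eqP.
by have /rowP/(_ k) := vC; rewrite mxE => ->; rewrite mxE.
Qed.

Lemma domain_F1fp (R : idomainType) : right_F1fp_coherent R.
Proof.
move=> F S N _ /finitely_generatedP[m [x xN]] flatN.
have [p [P [KP Ptest]]] :=
  finite_rank_test (fun v : 'rV[R]_m => lincomb x v = 0).
pose f i := row i P^T.
apply: (@flat_fp_of_tensor_relation R N _ m x f) => //.
  (* In the standard basis the sum becomes sum_l (sum_i P_li x_i) (x) e_l, whose left factors vanish
     because the rows of [P] are syzygies. *)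
  under eq_bigr => i _.
    rewrite [f i]row_sum_delta pure_tensor_sumr.
    under eq_bigr => l _ do rewrite -pure_tensorZ !mxE.
    over.
  rewrite exchange_big /= big1 // => l _; rewrite -pure_tensor_suml.
  rewrite -[RHS](@pure_tensor0l R N _ (delta_mx 0 l)).
  congr pure_tensor; rewrite -[RHS](KP l).
  by apply: eq_bigr => i _; rewrite mxE.
move=> C C0 v v0.
(* Read entrywise, [C0] says P C = 0 over [R^c]; commutativity carries this over to [R]. *)
have PC : P *m (C : 'M[R]_m) = 0.
  apply/matrixP => l k; have /rowP/(_ l) := C0 k.
  rewrite summxE !mxE; apply: etrans.
  by apply: eq_bigr => i _; rewrite !mxE mulrC.
have /rowP vC := Ptest _ _ PC v v0; apply/rowP => k; rewrite mxE.
have := vC k; rewrite !mxE; apply: etrans.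
by apply: eq_bigr => i _; rewrite /= [RHS]mulrC.
Qed.

(** * Divisible groups and injective modules *)

(** By Euclidean division, n is the least positive element, or 0 if there is none. *)
Lemma int_subgroup_dvdz (H : int -> Prop) :
  H 0 -> (forall k l, H k -> H l -> H (k - l)) ->
  exists n : nat, forall k, H k <-> (n %| k)%Z.
Proof.
move=> H0 HB.
have HN k : H k -> H (- k) by move=> Hk; rewrite -sub0r; apply: HB.
have HD k l : H k -> H l -> H (k + l).
  by move=> Hk /HN Hl; rewrite -[l]opprK; apply: HB.
have HMn k n : H k -> H (k *+ n).
  by move=> Hk; elim: n => [|n IHn]; rewrite ?mulr0n // mulrS; apply: HD.
have HM k l : H k -> H (k * l).
  move=> Hk; case: (intP l) => [|n|n]; rewrite ?mulr0 // ?mulrN -mulrzz.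
  - exact: HMn.
  - exact/HN/HMn.
have [[n n_gt0 Hn]|no_pos] := pselect (exists2 n : nat, (0 < n)%N & H n);
  last first.
  exists 0%N => k; rewrite dvd0z; split=> [Hk|/eqP->//]; apply/eqP.
  apply: contrapT => /eqP k0; apply: no_pos.
  exists `|k|%N; first by rewrite absz_gt0.
  by rewrite abszE; case: ger0P => _ //; apply: HN.
have exH : exists n : nat, (0 < n)%N && `[< H n >].
  by exists n; rewrite n_gt0; apply/asboolP.
case: (ex_minnP exH) => d /andP[d_gt0 /asboolP Hd] dmin.
exists d => k; split=> [Hk|/dvdzP[q ->]]; last by rewrite mulrC; apply: HM.
apply/dvdz_mod0P.
have dz : (d : int) != 0 by rewrite -lt0n.
have Hr : H (k %% d)%Z by rewrite /modz mulrC; apply/HB/HM.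
have : (k %% d)%Z < d by rewrite ltz_pmod.
move: (modz_ge0 k dz) Hr; case: (k %% d)%Z => // r _ Hr; rewrite ltz_nat => rd.
case: r Hr rd => // r Hr; rewrite ltnNge dmin //=; exact/asboolP.
Qed.

Lemma subrACA (V : zmodType) (x y z t : V) : x - y - (z - t) = x - z - (y - t).
Proof. by rewrite !opprB addrACA [RHS]addrACA [- y + _]addrC. Qed.

Definition divisible (D : zmodType) : Prop :=
  forall n (d : D), (0 < n)%N -> exists e, e *+ n = d.

(** * Extending homomorphisms into divisible groups *)

Section DivisibleExtension.
Variables (G D : zmodType).
Local Open Scope classical_set_scope.

(* T is the graph of a homomorphism from a subgroup of G to D. *)
Definition partial_hom (T : set (G * D)) : Prop :=
  [/\ T (0, 0),
      forall g d g' d', T (g, d) -> T (g', d') -> T (g - g', d - d')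
    & forall d, T (0, d) -> d = 0].

Lemma partial_homN T g d : partial_hom T -> T (g, d) -> T (- g, - d).
Proof. by move=> [T0 TB _] Tgd; rewrite -sub0r -(sub0r d); apply: TB. Qed.

Lemma partial_homMz T g d k : partial_hom T -> T (g, d) -> T (g *~ k, d *~ k).
Proof.
move=> PT Tgd; have [T0 TB _] := PT.
have TMn n : T (g *+ n, d *+ n).
  elim: n => [|n IHn]; rewrite ?mulr0n // !mulrS.
  rewrite -[g *+ n]opprK -[d *+ n]opprK.
  by apply: TB => //; apply: partial_homN.
by case: k => n; [exact: TMn|exact: partial_homN PT (TMn n.+1)].
Qed.

Lemma partial_hom_fun T g d d' :
  partial_hom T -> T (g, d) -> T (g, d') -> d = d'.
Proof.
move=> [_ TB Tfun] Td Td'; apply/eqP; rewrite -subr_eq0; apply/eqP/Tfun.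
by rewrite -(subrr g); apply: TB.
Qed.

(** The integers k with k x in the domain are the multiples of some n. Divisibility gives e with n e
    equal to the value at n x, and x can be sent to e. *)
Lemma partial_hom_extend T x : divisible D -> partial_hom T ->
  exists T', [/\ partial_hom T', T `<=` T' & exists e, T' (x, e)].
Proof.
move=> divD PT; have [T0 TB Tfun] := PT.
have [e eP] : exists e, forall k d, T (x *~ k, d) -> d = e *~ k.
  have [||n nP] := @int_subgroup_dvdz (fun k => exists d, T (x *~ k, d)).
  - by exists 0; rewrite mulr0z.
  - move=> k l [d Td] [d' Td']; exists (d - d').
    by rewrite mulrzBr; apply: TB Td Td'.
  have [d Td] : exists d, T (x *~ n, d) by apply/nP; rewrite dvdzz.
  have [e eP] : exists e, e *~ n = d.
    (* If n = 0, the value at 0 is 0 and e = 0 works; divisibility only covers positive n. *)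
    case: n {nP} Td => [|n] Td; last exact: divD.
    by exists 0; rewrite mulr0z (Tfun _ Td).
  exists e => k d' Td'; have /dvdzP[q qP] : (n %| k)%Z by apply/nP; exists d'.
  apply: (partial_hom_fun PT Td'); rewrite qP mulrC !mulrzA eP.
  exact: partial_homMz.
(* The new graph is [T] plus all integer multiples of (x, e). *)
exists (fun p => exists k, T (p.1 - x *~ k, p.2 - e *~ k)); split.
- split=> [|g d g' d' [k Tk] [l Tl]|d [k]] /=.
  + by exists 0; rewrite !mulr0z !subr0.
  + exists (k - l); rewrite !mulrzBr.
    by rewrite [g - _ - _]subrACA [d - _ - _]subrACA; apply: TB.
  + rewrite sub0r => /(partial_homN PT); rewrite opprK opprB => /eP.
    by move/eqP; rewrite subr_eq addrC -subr_eq subrr => /eqP.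
- by move=> [g d] Tgd; exists 0; rewrite !mulr0z !subr0.
- by exists e, 1; rewrite !mulr1z !subrr.
Qed.

(** [Zorn_bigcup] also asks about the empty chain, whose union is empty. Stating the property for
    the union of [A] with [T] covers this case and keeps [T] inside the maximal graph. *)
Lemma partial_hom_chain T (F : set (set (G * D))) :
  partial_hom T -> F `<=` [set A | partial_hom (A `|` T)] ->
  total_on F subset -> partial_hom (\bigcup_(A in F) A `|` T).
Proof.
move=> PT FP Ftot; have [T0 TB Tfun] := PT.
(* Any two points of the union lie in a single partial homomorphism contained in it. *)
have TF p q : (\bigcup_(A in F) A `|` T) p -> (\bigcup_(A in F) A `|` T) q ->
    exists B, [/\ partial_hom B, B p, B q & B `<=` \bigcup_(A in F) A `|` T].
  have sub A : F A -> A `|` T `<=` \bigcup_(A in F) A `|` T.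
    by move=> FA r [Ar|Tr]; [left; exists A|right].
  move=> [[A FA Ap]|Tp] [[B FB Bq]|Tq].
  - have [AB|BA] := Ftot _ _ FA FB.
      exists (B `|` T); split; [exact: FP| left; exact: AB| by left|exact: sub].
    exists (A `|` T); split; [exact: FP| by left| left; exact: BA|exact: sub].
  - exists (A `|` T); split; [exact: FP| by left| by right|exact: sub].
  - exists (B `|` T); split; [exact: FP| by right| by left|exact: sub].
  - exists T; split=> // r; by right.
split=> [|g d g' d' Tp Tq|d Td]; first by right.
  by have [B [[_ BB _] Bp Bq]] := TF _ _ Tp Tq; apply; apply: BB.
by have [B [[_ _ Bfun] Bd _ _]] := TF _ _ Td Td; apply: Bfun.
Qed.

Lemma partial_hom_total T : divisible D -> partial_hom T ->
  exists h : G -> D, {morph h : x y / x - y} /\ forall g d, T (g, d) -> h g = d.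
Proof.
move=> divD PT.
have [F FP Ftot|A [PA Amax]] := @Zorn_bigcup _ (fun A => partial_hom (A `|` T)).
  exact: partial_hom_chain.
have /choice[h hP] x : exists e, (A `|` T) (x, e).
  have [B [PB AB [e Be]]] := partial_hom_extend x divD PA.
  exists e; apply: contrapT => nAe; apply: (Amax B); last first.
    rewrite setUidl // => p Tp; apply: AB; by right.
  split=> [p Ap|BA]; first by apply: AB; left.
  by apply: nAe; left; apply: BA.
exists h; split=> [x y|g d Tgd]; last first.
  by apply: (partial_hom_fun PA (hP g)); right.
by apply: (partial_hom_fun PA (hP _)); have [_ AB _] := PA; apply: AB.
Qed.
End DivisibleExtension.

(** * Character modules *)

Section CharacterModule.
Variables (A : pzRingType) (D : zmodType).

Definition additive_fun : {pred A -> D} :=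
  fun f => `[< {morph f : x y / x - y} >].

Lemma additive_fun_zmod_closed : zmod_closed additive_fun.
Proof.
split=> [|f g /asboolP fB /asboolP gB]; apply/asboolP => x y.
  by rewrite subrr.
rewrite -[LHS]/(f (x - y) - g (x - y)) fB gB; exact: subrACA.
Qed.

HB.instance Definition _ :=
  GRing.isZmodClosed.Build (A -> D) additive_fun additive_fun_zmod_closed.

(** This is Hom_Z(A, D); acting by right multiplication on the argument makes it a left module. *)
Definition character := {f : A -> D | f \in additive_fun}.
HB.instance Definition _ := SubChoice.on character.
HB.instance Definition _ := [SubChoice_isSubZmodule of character by <:].

Lemma characterB (f : character) : {morph val f : x y / x - y}.
Proof. by have /asboolP := valP f. Qed.

Lemma characterD (f : character) : {morph val f : x y / x + y}.
Proof. by move=> x y; rewrite -[in RHS](addrK y x) characterB subrK. Qed.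

Lemma character_scale_subproof (a : A) (f : character) :
  (fun s => val f (s * a)) \in additive_fun.
Proof. by apply/asboolP => x y; rewrite mulrBl characterB. Qed.

Definition character_scale a f : character :=
  Sub (fun s => val f (s * a)) (character_scale_subproof a f).

Lemma characterP (f g : character) : (forall s, val f s = val g s) -> f = g.
Proof. by move=> fg; apply/val_inj/funext. Qed.

Lemma character_addE (f g : character) s : val (f + g) s = val f s + val g s.
Proof. by rewrite raddfD. Qed.

Lemma character_scaleA a b f :
  character_scale a (character_scale b f) = character_scale (a * b) f.
Proof. by apply: characterP => s; rewrite /= mulrA. Qed.

Lemma character_scale1 : left_id 1 character_scale.
Proof. by move=> f; apply: characterP => s; rewrite /= mulr1. Qed.

Lemma character_scaleDr : right_distributive character_scale +%R.
Proof. by move=> a f g; apply: characterP => s; rewrite !character_addE. Qed.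

Lemma character_scaleDl f : {morph character_scale^~ f : a b / a + b}.
Proof.
move=> a b; apply: characterP => s.
by rewrite character_addE /= mulrDr characterD.
Qed.

HB.instance Definition _ :=
  GRing.Zmodule_isLmodule.Build A character
    character_scaleA character_scale1 character_scaleDr character_scaleDl.

Lemma character_scaleE a (f : character) s : val (a *: f) s = val f (s * a).
Proof. by []. Qed.

(** Linear maps into Hom_Z(A, D) correspond to additive maps into D by evaluation at 1. So x |->
    f(x)(1) is extended from the image of [i] to an additive [h] on [N], and y |-> (r |-> h(r y)) is
    the required linear map. *)
Lemma character_injective : divisible D -> injective_module character.
Proof.
move=> divD M N i f i_inj.
pose T : set (N * D) := fun p => exists x, p = (i x, val (f x) 1).
have [|h [hB hT]] := @partial_hom_total N D T divD.
  split=> [|_ _ _ _ [x [-> ->]] [y [-> ->]]|d [x [ix ->]]].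
  - by exists 0; rewrite !raddf0.
  - by exists (x - y); rewrite !raddfB.
  - by have -> : x = 0; [apply: i_inj; rewrite -ix raddf0|rewrite !raddf0].
have hD : {morph h : x y / x + y}.
  by move=> x y; rewrite -[in RHS](addrK y x) hB subrK.
have hyP y : (fun r => h (r *: y)) \in additive_fun.
  by apply/asboolP => r s; rewrite scalerBl hB.
pose hat y : character := Sub (fun r => h (r *: y)) (hyP y).
have hat_linear : linear hat.
  move=> a y z; apply: characterP => s; rewrite character_addE character_scaleE.
  by rewrite /= scalerDr scalerA hD.
pose hathb := GRing.isLinear.Build A N character *:%R hat hat_linear.
pose hat_lin : {linear N -> character} := HB.pack hat hathb.
exists hat_lin => x; apply: characterP => r /=; rewrite -linearZ_LR.
rewrite (hT _ (val (f (r *: x)) 1)); last by exists (r *: x).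
by rewrite linearZ_LR character_scaleE mul1r.
Qed.

End CharacterModule.

(** * The divisible group Q/Z and separation of points *)

Definition int_rat : {pred rat} := fun q => q \is a Num.int.

Lemma int_rat_zmod_closed : zmod_closed int_rat.
Proof.
by split=> [|p q]; rewrite -!topredE /int_rat /= ?rpred0 //; apply: rpredB.
Qed.

HB.instance Definition _ :=
  GRing.isZmodClosed.Build rat int_rat int_rat_zmod_closed.

Definition rat_mod_int := Quotient.quot int_rat.
HB.instance Definition _ := Quotient.on rat_mod_int.
HB.instance Definition _ := GRing.Zmodule.on rat_mod_int.

Lemma pi_rat_mod_intMn (q : rat) n :
  \pi_rat_mod_int (q *+ n) = \pi_rat_mod_int q *+ n :> rat_mod_int.
Proof. exact: (raddfMn \pi_(Quotient.quot int_rat)). Qed.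

Lemma pi_rat_mod_int_eq0 (q : rat) :
  \pi_rat_mod_int q = 0 :> rat_mod_int <-> q \is a Num.int.
Proof.
have -> : 0 = \pi_rat_mod_int 0.
  exact/esym/(raddf0 \pi_(Quotient.quot int_rat)).
have : (q - 0 \in int_rat) = (q \is a Num.int) by rewrite subr0.
by rewrite Quotient.idealrBE => <-; split=> [->|/eqP].
Qed.

Lemma rat_mod_int_divisible : divisible rat_mod_int.
Proof.
move=> n d n_gt0; exists (\pi_rat_mod_int (repr d / n%:R)).
rewrite -pi_rat_mod_intMn -[_ / _ *+ n]mulr_natr divfK ?reprK //.
by rewrite pnatr_eq0 -lt0n.
Qed.

Lemma fct_divisible (J : Type) (D : zmodType) :
  divisible D -> divisible (J -> D).
Proof.
move=> divD n d n_gt0; have /choice[e eP] k := divD n (d k) n_gt0.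
exists e; apply/funext => k; rewrite -eP.
by elim: n {n_gt0 eP} => [|n IHn] //; rewrite !mulrS -IHn.
Qed.

Lemma rat_mod_int_element (n : nat) : n != 1%N ->
  exists q : rat_mod_int, q != 0 /\ q *+ n = 0.
Proof.
(* The class of 1/n has order n; for n = 0 any nonzero class will do, and that of 1/2 is taken. *)
move=> n1; pose d : rat := if n is 0%N then 2%:R else n%:R.
have d0 : d != 0 by rewrite /d; case: (n) => //= k; rewrite pnatr_eq0.
exists (\pi_rat_mod_int d^-1); split; last first.
  rewrite -pi_rat_mod_intMn; apply/pi_rat_mod_int_eq0.
  case: n n1 @d d0 => [|n] _ d d0; first by rewrite mulr0n rpred0.
  by rewrite -[_ *+ _]mulr_natr mulVf ?rpred1.
apply/eqP => /pi_rat_mod_int_eq0/intrP[z dz].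
have d_gt1 : 1 < d by rewrite /d; case: (n) n1 => [|[|k]] //= _; rewrite ltr1n.
have : 0 < d^-1 < 1.
  by rewrite invr_gt0 invf_lt1 ?d_gt1 ?andbT // (lt_trans _ d_gt1).
rewrite dz ltr0z -[1]/(1%:~R) ltr_int => /andP[].
by case: z {dz} => [[|z]|z].
Qed.

(** Let n be the additive order of [a], or 0 if it is infinite. If [a] is nonzero then n is not 1,
    so [a] can be sent to some nonzero q with n q = 0, and this extends from the multiples of [a] to
    the whole ring. *)
Lemma character_separates (A : pzRingType) (a : A) :
  (forall f : character A rat_mod_int, val f a = 0) -> a = 0.
Proof.
move=> a0; apply: contrapT => an0.
have [||n nP] := @int_subgroup_dvdz (fun k => a *~ k = 0).
- by rewrite mulr0z.
- by move=> k l ka la; rewrite mulrzBr ka la subrr.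
have [|q [q0 qn]] := @rat_mod_int_element n.
  by apply/eqP => n1; apply: an0; rewrite -[a]mulr1z; apply/nP; rewrite n1.
pose T : set (A * rat_mod_int) := fun p => exists k, p = (a *~ k, q *~ k).
have [|h [hB hT]] := @partial_hom_total _ _ T rat_mod_int_divisible.
  split=> [|_ _ _ _ [k [-> ->]] [l [-> ->]]|d [k [ak ->]]].
  - by exists 0; rewrite !mulr0z.
  - by exists (k - l); rewrite !mulrzBr.
  - have /dvdzP[j ->] : (n %| k)%Z by apply/nP.
    by rewrite mulrC mulrzA -pmulrn qn mul0rz.
have hadd : h \in @additive_fun A rat_mod_int by apply/asboolP.
have := a0 (Sub h hadd); rewrite /= (hT a q) => [qn0|].
  by rewrite qn0 eqxx in q0.
by exists 1; rewrite !mulr1z.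
Qed.

(** * Embedding a power of the ring into a module of homomorphisms between injectives *)

Section DoubleDual.
Variables (A : comPzRingType) (J : Type).
Local Notation E := (character A rat_mod_int).
Local Notation EJ := (character A (J -> rat_mod_int)).

Lemma double_dual_subproof (xi : J -> A^o) (f : E) :
  (fun r k => val f (r * xi k)) \in @additive_fun A (J -> rat_mod_int).
Proof.
by apply/asboolP => x y; apply/funext => k; rewrite mulrBl characterB.
Qed.

(** With [EJ] identified with the power of [E] indexed by [J], this is f |-> (xi_k f)_k,
    multiplication by xi_k in each coordinate. *)
Definition double_dual_fun xi f : EJ :=
  Sub (fun r k => val f (r * xi k)) (double_dual_subproof xi f).

Lemma double_dual_fun_linear xi : linear (double_dual_fun xi).
Proof.
move=> a f g; apply: characterP => r; apply/funext => k.
transitivity (val (a *: f + g) (r * xi k)) => //.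
by rewrite character_addE character_scaleE mulrAC.
Qed.

HB.instance Definition _ xi :=
  GRing.isLinear.Build A E EJ *:%R (double_dual_fun xi)
    (double_dual_fun_linear xi).

Definition double_dual (xi : J -> A^o) : Defs.hom E EJ :=
  (double_dual_fun xi : {linear E -> EJ}).

Lemma double_dual_linear : linear double_dual.
Proof.
move=> a xi eta; apply: homP => f; apply: characterP => r; apply/funext => k.
rewrite -[RHS]/(val f (r * a * xi k) + val f (r * eta k)).
by rewrite -characterD -mulrA -mulrDr.
Qed.

HB.instance Definition _ :=
  GRing.isLinear.Build A (J -> A^o) (Defs.hom E EJ) *:%R double_dual
    double_dual_linear.

Lemma double_dual_eq0 xi : double_dual xi = 0 -> xi = 0.
Proof.
move=> xi0; apply/funext => k; apply: character_separates => f.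
have : double_dual xi f = 0 by rewrite xi0.
move/(congr1 (fun c : EJ => val c 1 k)) => /=.
by rewrite mul1r.
Qed.

End DoubleDual.

(** * Semi-coherent rings *)

Section CommutativeSides.
Variable R : comPzRingType.

(* The ring structures of R and R^c are equal but not convertible, so a right
   module has to be turned into a left one explicitly. *)
Definition left_of (M : lmodType R^c) : Type := M.

HB.instance Definition _ M := GRing.Zmodule.on (left_of M).

Section Scale.
Variable M : lmodType R^c.

Definition left_scale (a : R) (x : left_of M) : left_of M :=
  (a : R^c) *: (x : M).

Lemma left_scaleA a b x : left_scale a (left_scale b x) = left_scale (a * b) x.
Proof. by rewrite /left_scale scalerA mulrC. Qed.

Lemma left_scale1 : left_id 1 left_scale.
Proof. exact: scale1r. Qed.

Lemma left_scaleDr : right_distributive left_scale +%R.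
Proof. by move=> a x y; apply: scalerDr. Qed.

Lemma left_scaleDl x : {morph left_scale^~ x : a b / a + b}.
Proof. by move=> a b; apply: scalerDl. Qed.

HB.instance Definition _ :=
  GRing.Zmodule_isLmodule.Build R (left_of M)
    left_scaleA left_scale1 left_scaleDr left_scaleDl.

End Scale.

Definition left_map (M N : lmodType R^c) (f : {linear M -> N}) :
  left_of M -> left_of N := f.

Lemma left_map_linear (M N : lmodType R^c) (f : {linear M -> N}) :
  linear (left_map f).
Proof. by move=> a x y; rewrite /left_map linearP. Qed.

HB.instance Definition _ (M N : lmodType R^c) (f : {linear M -> N}) :=
  GRing.isLinear.Build R (left_of M) (left_of N) *:%R (left_map f)
    (left_map_linear f).

(** Flatness of F concerns F (x) N, whereas the equational criterion for N concerns N (x) F. The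
    flip of the two factors is balanced by commutativity. *)
Lemma tensor_swap_eq0 (M N : lmodType R^c) m (x : 'I_m -> M) (y : 'I_m -> N) :
  \sum_i pure_tensor (x i) (y i : left_of N) = 0 ->
  \sum_i pure_tensor (y i) (x i : left_of M) = 0.
Proof.
apply: (@balanced_sum_eq0 _ M (left_of N) _
  (fun u v => pure_tensor (v : N) (u : left_of M))).
split=> [u u' v|u v v'|u r v].
- exact: pure_tensorDr.
- exact: pure_tensorDl.
- exact/esym/(pure_tensorZ (v : N) r (u : left_of M)).
Qed.

End CommutativeSides.

Lemma semi_coherent_F1fp (R : comPzRingType) :
  semi_coherent R -> right_F1fp_coherent R.
Proof.
move=> scR F0 S N F0free /finitely_generatedP[m [x xN]] flatN.
have [n [b [X [xX kerX]]]] := sub_free_coordinates x F0free.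
have injE := character_injective rat_mod_int_divisible (A := R^c).
pose J := {v : 'rV[R^c]_m | lincomb x v = 0}.
have injC := character_injective
  (@fct_divisible J _ rat_mod_int_divisible) (A := R^c).
have [F [SF [NF [phi [flatF phi_bij]]]]] := scR _ _ injE injC.
pose xi i : J -> R^c^o := fun v => sval v 0 i.
pose f i : F := val (phi (double_dual (xi i))).
(* Both [phi] and [double_dual] are injective and linear, so the [f i] satisfy the same relations as
   the coordinate functions [xi i]. *)
have fP (a : 'I_m -> R^c) : \sum_i a i *: f i = 0 <-> \sum_i a i *: xi i = 0.
  have -> : \sum_i a i *: f i = val (phi (double_dual (\sum_i a i *: xi i))).
    by rewrite !linear_sum; apply: eq_bigr => i _; rewrite !linearZ_LR.
  split=> [f0|->]; last by rewrite !raddf0.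
  apply/double_dual_eq0/(bij_inj phi_bij)/val_inj.
  by rewrite f0 !raddf0.
have xiE (a : 'I_m -> R^c) v : (\sum_i a i *: xi i) v = \sum_i a i * sval v 0 i.
  by rewrite fct_sumE.
have [iota iotaE] : exists iota : {linear left_of N -> left_of F0},
    forall y, iota y = val y.
  by exists (left_map (\val : {linear N -> F0})).
have ix i : iota (x i) = \sum_l (X i l : R) *: (b l : left_of F0).
  by rewrite iotaE xX; apply: eq_bigr => l _; rewrite mxE.
have fx0 : \sum_i pure_tensor (f i) (x i : left_of N) = 0.
  apply: (flatF _ _ iota) => [y z|]; first by rewrite !iotaE => /val_inj.
  rewrite raddf0 raddf_sum.
  under eq_bigr => i _.
    rewrite /= tensor_map_pure ix pure_tensor_sumr.
    under eq_bigr => l _ do rewrite -pure_tensorZ.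
    over.
  rewrite exchange_big big1 //= => l _; rewrite -pure_tensor_suml.
  (* By [fP] this can be tested on coordinate functions, that is, on each syzygy v, where it reads v
     X = 0. *)
  have -> : \sum_i (X i l : R^c) *: f i = 0.
    apply/fP/funext => v; rewrite xiE.
    have /kerX/rowP/(_ l) := svalP v; rewrite !mxE; apply: etrans.
    by apply: eq_bigr => i _; rewrite mulrC.
  exact: pure_tensor0l.
apply: (flat_fp_of_tensor_relation flatN xN (tensor_swap_eq0 fx0)) => C C0 v v0.
apply/rowP => k; rewrite !mxE.
(* Column k of [C] kills [f], hence also the coordinate functions; evaluating at the syzygy [v]
   gives the k-th entry of v C = 0. *)
have /fP/(congr1 (fun g => g (exist _ v v0))) := C0 k.
rewrite xiE; apply: etrans.
by apply: eq_bigr => i _; rewrite mulrC.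
Qed.

Theorem proposition3p2 :
  (forall R : pzRingType, right_semihereditary R -> right_F1fp_coherent R) /\
  ((forall R : pzRingType, right_coherent R -> right_F1fp_coherent R) /\
   (forall R : pzRingType, right_noetherian R -> right_F1fp_coherent R)) /\
  (forall R : pzRingType, right_perfect R -> right_F1fp_coherent R) /\
  (forall R : comPzRingType, semi_coherent R -> right_F1fp_coherent R) /\
  (forall R : idomainType, right_F1fp_coherent R).
Proof.
split; first by move=> R /semihereditary_coherent/coherent_F1fp.
split; first by split; [exact: coherent_F1fp|exact: noetherian_F1fp].
split; first exact: perfect_F1fp.
by split; [exact: semi_coherent_F1fp|exact: domain_F1fp].
Qed.
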